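(* Let $V\colon\mathbb{R}^2\to\mathbb{R}$ be continuous with $\inf_{\mathbb{R}^2}V>0$, and suppose that $H^1_V(\mathbb{R}^2)$ is continuously embedded in $L^\tau_V(\mathbb{R}^2)$ for some $\tau>2$. Assume that there exist $c_1>0$, $c_2>0$, $m>0$ and a sequence $\{x_n\}_n\subset\mathbb{R}^2$ with $|x_n|\to+\infty$ such that for every $n\ge1$, \[ c_1V(x_n)\le V(x)\le c_2V(x_n)\quad\text{for all }x\in B_{m/\sqrt{V(x_n)}}(x_n). \] Then $H^1_V(\mathbb{R}^2)$ is not compactly embedded in $L^\tau_V(\mathbb{R}^2)$.
   Context: $H^1_V(\mathbb{R}^2)$ is the completion of $C_0^\infty(\mathbb{R}^2)$ with respect to the norm $\|u\|_V=\left(\int_{\mathbb{R}^2}(|\nabla u|^2+V(x)|u|^2)\,dx\right)^{1/2}$. $L^\tau_V(\mathbb{R}^2)$ is the space of measurable $u$ with $\int_{\mathbb{R}^2}V(x)|u|^\tau dx<+\infty$, normed by $\left(\int V|u|^\tau\right)^{1/\tau}$. $B_r(x)$ is the open ball of radius $r$ centered at $x$. *)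

(* Defs.v *)
From HB Require Import structures.
From mathcomp Require Import all_boot all_order all_algebra.
From mathcomp Require Import all_classical all_reals all_analysis.
Set Implicit Arguments. Unset Strict Implicit. Unset Printing Implicit Defensive.
Import Order.TTheory GRing.Theory Num.Theory.
Import numFieldNormedType.Exports.
Local Open Scope classical_set_scope.
Local Open Scope ring_scope.

(* The plane R^2 is modelled as R * R, with the product (Borel) sigma-algebra,
   the product topology and Lebesgue measure leb2 = lebesgue \x lebesgue. *)

Section Defs.
Variable R : realType.
Local Notation R2 := (R * R)%type.

Definition leb2 := (@lebesgue_measure R \x @lebesgue_measure R)%E.

Definition enorm (x : R2) : R := Num.sqrt (x.1 ^+ 2 + x.2 ^+ 2).

Definition eball (x : R2) (r : R) : set R2 := [set y | enorm (y - x) < r].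

Definition e1 : R2 := (1, 0).
Definition e2 : R2 := (0, 1).

Definition iter_deriv (l : seq R2) (f : R2 -> R) : R2 -> R :=
  foldr (fun v g => 'D_v g) f l.

Definition smooth (f : R2 -> R) : Prop :=
  forall l : seq R2, all (fun v => (v == e1) || (v == e2)) l ->
    continuous (iter_deriv l f) /\
    forall (v : R2) (x : R2), (v == e1) || (v == e2) ->
      derivable (iter_deriv l f) x v.

Definition test_fun (f : R2 -> R) : Prop :=
  smooth f /\ exists r : R, forall x, r < enorm x -> f x = 0.

Definition grad2 (f : R2 -> R) (x : R2) : R :=
  ('D_e1 f x) ^+ 2 + ('D_e2 f x) ^+ 2.

Definition HV_norm2 (V : R2 -> R) (f : R2 -> R) : \bar R :=
  (\int[leb2]_x (grad2 f x + V x * (f x) ^+ 2)%:E)%E.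

(* ||f||_V for test functions (the integral is finite) *)
Definition HV_norm (V : R2 -> R) (f : R2 -> R) : R :=
  Num.sqrt (fine (HV_norm2 V f)).

Definition LtauV_int (V : R2 -> R) (tau : R) (u : R2 -> R) : \bar R :=
  (\int[leb2]_x (V x * `|u x| `^ tau)%:E)%E.

Definition in_LtauV (V : R2 -> R) (tau : R) (u : R2 -> R) : Prop :=
  measurable_fun setT u /\ (LtauV_int V tau u < +oo)%E.

Definition LtauV_norm (V : R2 -> R) (tau : R) (u : R2 -> R) : R :=
  (fine (LtauV_int V tau u)) `^ tau^-1.

(* phi is a sequence of test functions, Cauchy for ||.||_V, converging
   to u in L^2_V; such u are exactly the elements of the completion
   H^1_V (realised as functions), with ||u||_V = lim ||phi k||_V. *)
Definition H1V_approx (V : R2 -> R) (u : R2 -> R) (phi : nat -> R2 -> R) : Prop :=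
  [/\ forall k, test_fun (phi k),
      (forall k, (HV_norm2 V (phi k) < +oo)%E),
      (forall e : R, 0 < e -> \forall p \near (\oo, \oo),
          HV_norm V (phi p.1 \- phi p.2) < e),
      measurable_fun setT u &
      (fun k => LtauV_int V 2 (phi k \- u)) @ \oo --> 0%E].

Definition in_H1V (V : R2 -> R) (u : R2 -> R) : Prop :=
  exists phi, H1V_approx V u phi.

Definition H1V_norm_along (V : R2 -> R) (phi : nat -> R2 -> R) : R :=
  lim ((fun k => HV_norm V (phi k)) @ \oo).

Definition cont_embed (V : R2 -> R) (tau : R) : Prop :=
  exists C : R, 0 < C /\
    forall u phi, H1V_approx V u phi ->
      in_LtauV V tau u /\ LtauV_norm V tau u <= C * H1V_norm_along V phi.

Definition H1V_bounded (V : R2 -> R) (u : nat -> R2 -> R) : Prop :=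
  exists M : R, forall n, exists phi, H1V_approx V (u n) phi /\
     H1V_norm_along V phi <= M.

Definition compact_embed (V : R2 -> R) (tau : R) : Prop :=
  forall u : nat -> R2 -> R, (forall n, in_H1V V (u n)) -> H1V_bounded V u ->
    exists (sigma : nat -> nat) (w : R2 -> R),
      (forall n, (sigma n < sigma n.+1)%N) /\ in_LtauV V tau w /\
      (fun n => LtauV_int V tau (u (sigma n) \- w)) @ \oo --> 0%E.

End Defs.

(* Main.v *)
(* Put a smooth bump at each [x n], rescaled to the length [1 / sqrt (V (x n))].
   On the support of the n-th bump [V] is comparable to [V (x n)], and the plane
   is exactly the dimension in which this scaling leaves the Dirichlet integral
   unchanged, so the bumps stay bounded in H^1_V while their L^tau_V norms stay
   away from 0.  As [V] is bounded below, the supports have bounded diameter and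
   run off to infinity; a later bump vanishes where a given one is large, and no
   subsequence can converge in L^tau_V.  All integrals are estimated by constants
   on squares, so no change of variables is needed.  The profile is
   [f (1 + s) * f (1 - s)] with [f t = exp (- 1 / t)] for [t > 0]. *)

Require Import Defs.
From HB Require Import structures.
From mathcomp Require Import all_boot all_order all_algebra.
From mathcomp Require Import all_classical all_reals all_analysis.
From mathcomp Require Import measurable_realfun ring lra.
Set Implicit Arguments.
Unset Strict Implicit.
Unset Printing Implicit Defensive.
Import Order.TTheory GRing.Theory Num.Theory.
Import numFieldNormedType.Exports.
Local Open Scope classical_set_scope.
Local Open Scope ring_scope.

(** * Flat functions of one variable and their derivatives *)

Section FlatFunctions.
Variable R : realType.
Implicit Types (p : {poly R}) (f g : R -> R) (s t : R).

(** The classical flat function exp(-1/t), with a polynomial in 1/t as an extra factor so that the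
    family is closed under differentiation. *)
Definition flat p t : R := if 0 < t then p.[t^-1] * expR (- t^-1) else 0.

Lemma flat_gt0E p t : 0 < t -> flat p t = p.[t^-1] * expR (- t^-1).
Proof. by rewrite /flat => ->. Qed.

Lemma flat_le0 p t : t <= 0 -> flat p t = 0.
Proof. by rewrite /flat leNgt => /negbTE ->. Qed.

(** The exponential series gives t^i <= i! exp(t) for t > 0, so each monomial of [p] contributes at
    most its coefficient in absolute value times i!. *)
Lemma horner_expRN_bounded p :
  exists2 C, 0 <= C & forall t, 0 < t -> `|p.[t] * expR (- t)| <= C.
Proof.
exists (\sum_(i < size p) `|p`_i| * i`!%:R).
  by apply: sumr_ge0 => i _; rewrite mulr_ge0.
move=> t t0; rewrite horner_coef mulr_suml (le_trans (ler_norm_sum _ _ _))//.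
apply: ler_sum => i _; rewrite !normrM -mulrA ler_wpM2l//.
rewrite normrX (gtr0_norm t0) (gtr0_norm (expR_gt0 _)) expRN.
rewrite ler_pdivrMr ?expR_gt0//; case: (nat_of_ord i) => [|n].
  by rewrite expr0 mul1r -[leLHS]addr0 (le_trans _ (expR_ge1Dx t))// lerD2l ltW.
rewrite -ler_pdivrMl ?ltr0n ?fact_gt0// mulrC.
by rewrite (le_trans _ (expR_ge1Dxn n (ltW t0)))// lerDr.
Qed.

Lemma flat_bounded p : exists2 C, 0 <= C & forall t, `|flat p t| <= C.
Proof.
have [C C0 hC] := horner_expRN_bounded p; exists C => // t.
have [t0|t0] := ltP 0 t; last by rewrite flat_le0// normr0.
by rewrite flat_gt0E// hC ?invr_gt0.
Qed.

(** Multiplying [p] by 'X^2 divides the flat function by t^2 and stays in the bounded family. This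
    is what gives the derivative at 0. *)
Lemma flat_quadratic p :
  exists2 C, 0 <= C & forall t, `|flat p t| <= C * t ^+ 2.
Proof.
have [C C0 hC] := flat_bounded ('X^2 * p); exists C => // t.
have [t0|t0] := ltP 0 t; last by rewrite flat_le0// normr0 mulr_ge0 ?sqr_ge0.
have := hC t; rewrite !flat_gt0E// hornerM hornerXn -mulrA normrM.
by rewrite normrX gtr0_norm ?invr_gt0// exprVn ler_pdivrMl ?exprn_gt0// (mulrC C).
Qed.

(** The bound forces f(0) = 0, and the difference quotient at 0 is then squeezed by C|h|. *)
Lemma is_derive0_quadratic f C :
  0 <= C -> (forall t, `|f t| <= C * t ^+ 2) -> is_derive (0 : R) 1 f 0.
Proof.
move=> C0 fC.
have f0 : f 0 = 0.
  by apply/normr0_eq0/le_anti; rewrite normr_ge0 andbT (le_trans (fC 0))// expr0n mulr0.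
have H : h^-1 *: (f (h *: (1 : R) + 0) - f 0) @[h --> (0:R)^'] --> (0 : R).
  apply/norm_cvg0P.
  apply: (@squeeze_cvgr _ _ _ _ (cst 0) (fun h : R => C * `|h|)).
  - near=> h.
    rewrite normr_ge0/= f0 subr0 addr0 normrM normfV ler_pdivrMl.
      rewrite (_ : `|h| * _ = C * h ^+ 2); first by rewrite [_ *: _]mulr1 fC.
      by rewrite -real_normK ?num_real// expr2; ring.
    by rewrite normr_gt0; near: h; exact: nbhs_dnbhs_neq.
  - exact: cvg_cst.
  - rewrite -[X in _ --> X](mulr0 C).
    apply: cvgM; first exact: cvg_cst.
    by apply/norm_cvg0P; exact: nbhs_dnbhs.
by split; [apply/cvg_ex; exists 0|apply/cvg_lim].
Unshelve. all: by end_near. Qed.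

(** For t > 0 this is the product and chain rule, where d(1/t)/dt = -1/t^2 produces the factor 'X^2.
    For t < 0 the function is locally 0, and at 0 the quadratic bound applies. *)
Lemma is_derive_flat p t : is_derive t 1 (flat p) (flat ('X^2 * (p - p^`())) t).
Proof.
have [t0|t0|<-] := ltgtP 0 t.
- have tN0 : t != 0 by rewrite gt_eqF.
  apply: (@near_eq_is_derive _ _ _ (fun s => p.[s^-1] * expR (- s^-1))).
    near=> s; rewrite flat_gt0E//; near: s.
    exact: lt_nbhsr.
  have dV : is_derive t 1 (fun s : R => s^-1) (- t ^- 2).
    by apply: is_derive_eq; first exact: (is_deriveV tN0); rewrite [_ *: _]mulr1.
  have dp := is_derive1_comp (is_derive_poly p t^-1) dV.
  have de := @is_derive1_comp _ expR (fun s : R => - s^-1) _ _ _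
    (is_derive_expR (- t^-1)) (is_deriveN dV).
  have dpe := is_deriveM dp de.
  apply: (is_derive_eq dpe).
  rewrite flat_gt0E// !hornerE /GRing.scale/= /comp/=.
  by rewrite -exprVn; ring.
- rewrite flat_le0 ?ltW//.
  apply: (@near_eq_is_derive _ _ _ (cst (0 : R))).
    near=> s; rewrite flat_le0//; near: s.
    by apply: filterS (lt_nbhsl t0) => z /ltW.
- rewrite flat_le0//; have [C C0 hC] := flat_quadratic p.
  exact: is_derive0_quadratic C0 hC.
Unshelve. all: by end_near. Qed.

End FlatFunctions.

(** * The algebra generated by flat functions of affine arguments *)

Section SmoothAlgebra.
Variable R : realType.
Implicit Types (f g : R -> R).

(* An explicit class of functions closed under differentiation, so that its
   members are smooth. *)
Inductive flat_algebra : (R -> R) -> Prop :=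
| flat_algebra_affine p a c : flat_algebra (fun s => flat p (a + c * s))
| flat_algebraD f g : flat_algebra f -> flat_algebra g ->
    flat_algebra (fun s => f s + g s)
| flat_algebraM f g : flat_algebra f -> flat_algebra g ->
    flat_algebra (fun s => f s * g s)
| flat_algebraZ c f : flat_algebra f -> flat_algebra (fun s => c * f s).

Lemma is_derive_flat_affine p (a c s : R) :
  is_derive s 1 (fun t => flat p (a + c * t))
    (c * flat ('X^2 * (p - p^`())) (a + c * s)).
Proof.
have d : is_derive s 1 (fun t : R => a + c * t) c.
  have dZ := is_deriveZ c (is_derive_id s (1 : R)).
  have dD := is_deriveD (is_derive_cst a s (1 : R)) dZ.
  by apply: (is_derive_eq dD); rewrite add0r [_ *: _]mulr1.
have dc := @is_derive1_comp _ (flat p) (fun t => a + c * t) s _ _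
  (is_derive_flat p (a + c * s)) d.
apply: (is_derive_eq dc).
exact: mulrC.
Qed.

Lemma flat_algebra_derive f : flat_algebra f ->
  exists2 f', flat_algebra f' & forall s : R, is_derive s 1 f (f' s).
Proof.
elim=> {f} [p a c|f g _ [f' ff' df] _ [g' gg' dg]|f g ff [f' ff' df] gg [g' gg' dg]|
            c f _ [f' ff' df]].
- eexists; last by move=> s; exact: is_derive_flat_affine.
  by apply: flat_algebraZ; exact: flat_algebra_affine.
- exists (fun s => f' s + g' s); first exact: flat_algebraD.
  by move=> s; exact: is_deriveD.
- exists (fun s => f s * g' s + g s * f' s).
    by apply: flat_algebraD; exact: flat_algebraM.
  by move=> s; exact: is_deriveM.
- exists (fun s => c * f' s); first exact: flat_algebraZ.
  by move=> s; exact: is_deriveZ.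
Qed.

Lemma flat_algebra_continuous f : flat_algebra f -> continuous f.
Proof.
move=> /flat_algebra_derive[f' _ df] s.
by apply: differentiable_continuous; apply/derivable1_diffP; apply: ex_derive.
Qed.

End SmoothAlgebra.

(** * Smooth functions on the plane as products of one-variable functions *)

Section TensorProducts.
Variable R : realType.
Local Notation R2 := (R * R)%type.
Implicit Types (f g : R -> R).

Definition tensor f g (y : R2) : R := f y.1 * g y.2.

(** Along [e1] the second factor is constant, so the difference quotient is the one-variable
    quotient of [f] times that constant. *)
Lemma is_derive_tensor1 f g (a : R) (y : R2) : is_derive y.1 1 f a ->
  is_derive y (e1 R) (tensor f g) (a * g y.2).
Proof.
move=> [df <-].
have H : h^-1 *: (tensor f g (h *: e1 R + y) - tensor f g y) @[h --> (0:R)^']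
    --> 'D_1 f y.1 * g y.2.
  have -> : (fun h => h^-1 *: (tensor f g (h *: e1 R + y) - tensor f g y)) =
      (fun h => (h^-1 *: (f (h *: (1 : R) + y.1) - f y.1)) * g y.2).
    apply/funext => h; rewrite /tensor/= [h *: 0]mulr0 add0r -mulrBl.
    by rewrite /GRing.scale/= mulrA.
  by apply: cvgM; [exact: df|exact: cvg_cst].
by split; [apply/cvg_ex; eexists; exact: H|apply/cvg_lim].
Qed.

Lemma is_derive_tensor2 f g (a : R) (y : R2) : is_derive y.2 1 g a ->
  is_derive y (e2 R) (tensor f g) (f y.1 * a).
Proof.
move=> [dg <-].
have H : h^-1 *: (tensor f g (h *: e2 R + y) - tensor f g y) @[h --> (0:R)^']
    --> f y.1 * 'D_1 g y.2.
  have -> : (fun h => h^-1 *: (tensor f g (h *: e2 R + y) - tensor f g y)) =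
      (fun h => f y.1 * (h^-1 *: (g (h *: (1 : R) + y.2) - g y.2))).
    apply/funext => h; rewrite /tensor/= [h *: 0]mulr0 add0r -mulrBr.
    by rewrite /GRing.scale/= mulrCA.
  by apply: cvgM; [exact: cvg_cst|exact: dg].
by split; [apply/cvg_ex; eexists; exact: H|apply/cvg_lim].
Qed.

(** Each partial derivative differentiates a single factor, which stays in the algebra. Smoothness
    thus reduces to continuity and one further derivative of such products. *)
Lemma iter_deriv_tensor f g l : flat_algebra f -> flat_algebra g ->
  all (fun v => (v == e1 R) || (v == e2 R)) l ->
  exists f' g', [/\ flat_algebra f', flat_algebra g' &
    iter_deriv l (tensor f g) = tensor f' g'].
Proof.
move=> ff gg; elim: l => [_|v l IH /=/andP[vl /IH[f' [g' [ff' gg' ->]]]]].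
  by exists f, g.
have [f'' ff'' df] := flat_algebra_derive ff'.
have [g'' gg'' dg] := flat_algebra_derive gg'.
case/orP: vl => /eqP ->.
- exists f'', g'; split => //; apply/funext => y.
  by have [_ ->] := is_derive_tensor1 g' (df y.1).
- exists f', g''; split => //; apply/funext => y.
  by have [_ ->] := is_derive_tensor2 f' (dg y.2).
Qed.

Lemma tensor_continuous f g : continuous f -> continuous g ->
  continuous (tensor f g).
Proof.
move=> cf cg y; apply: cvgM.
  by apply: continuous_comp; [exact: cvg_fst|exact: cf].
by apply: continuous_comp; [exact: cvg_snd|exact: cg].
Qed.

Lemma smooth_tensor f g : flat_algebra f -> flat_algebra g ->
  smooth (tensor f g).
Proof.
move=> ff gg l /(iter_deriv_tensor ff gg)[f' [g' [ff' gg' ->]]].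
have [f'' _ df] := flat_algebra_derive ff'.
have [g'' _ dg] := flat_algebra_derive gg'.
split; first by apply: tensor_continuous; exact: flat_algebra_continuous.
move=> v y /orP[|] /eqP ->.
- by have [] := is_derive_tensor1 g' (df y.1).
- by have [] := is_derive_tensor2 f' (dg y.2).
Qed.

End TensorProducts.

(** * The bump profile, its rescaled planar cutoffs and their supporting squares *)

Section Bump.
Variable R : realType.
Local Notation R2 := (R * R)%type.
Implicit Types (s t z r : R).

Definition bump s : R := flat 1 (1 + s) * flat 1 (1 - s).

Lemma flat1_ge0 t : 0 <= flat 1 t.
Proof. by rewrite /flat; case: ifP => // _; rewrite hornerC mul1r expR_ge0. Qed.

Lemma flat1_le1 t : flat 1 t <= 1.
Proof.
rewrite /flat; case: ifP => [t0|_]; last exact: ler01.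
by rewrite hornerC mul1r -expR0 ler_expR oppr_le0 invr_ge0 ltW.
Qed.

Lemma flat1_ge t : 2^-1 <= t -> expR (- 2) <= flat 1 t.
Proof.
move=> t2; have t0 : 0 < t by rewrite (lt_le_trans _ t2)// invr_gt0.
rewrite flat_gt0E// hornerC mul1r ler_expR lerN2.
by rewrite -[leRHS]invrK lef_pV2// posrE invr_gt0.
Qed.

Lemma bump_ge0 s : 0 <= bump s.
Proof. by rewrite mulr_ge0 ?flat1_ge0. Qed.

Lemma bump_le1 s : bump s <= 1.
Proof. by rewrite mulr_ile1 ?flat1_ge0 ?flat1_le1. Qed.

(** One of 1 + s and 1 - s is nonpositive. The polynomials are arbitrary so that the profile and its
    derivative are both covered. *)
Lemma flat_mul_eq0 p q s : 1 <= `|s| -> flat p (1 + s) * flat q (1 - s) = 0.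
Proof.
rewrite ler_normr => /orP[s1|s1].
- by rewrite [flat q _]flat_le0 ?mulr0// subr_le0.
- by rewrite [flat p _]flat_le0 ?mul0r// -lerBrDl sub0r lerNr.
Qed.

Lemma bump_eq0 s : 1 <= `|s| -> bump s = 0.
Proof. exact: flat_mul_eq0. Qed.

Lemma bump_ge s : `|s| <= 2^-1 -> expR (- 4) <= bump s.
Proof.
rewrite ler_norml => /andP[s1 s2].
have -> : - 4 = - 2 + - 2 :> R by ring.
by rewrite expRD ler_pM ?expR_ge0// flat1_ge//; lra.
Qed.

(** The derivative of [bump]: for p = 1 the polynomial 'X^2 * (p - p') is 'X^2, and the minus sign
    comes from the inner function 1 - s. *)
Definition dbump s : R :=
  flat 'X^2 (1 + s) * flat 1 (1 - s) - flat 1 (1 + s) * flat 'X^2 (1 - s).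

Lemma dbump_eq0 s : 1 <= `|s| -> dbump s = 0.
Proof. by move=> s1; rewrite /dbump !flat_mul_eq0// subr0. Qed.

Lemma dbump_bounded : exists2 K, 0 <= K & forall s, `|dbump s| <= K.
Proof.
have [C C0 hC] := flat_bounded ('X^2 : {poly R}).
have h1 t : `|flat 1 t| <= 1 by rewrite ger0_norm ?flat1_ge0// flat1_le1.
exists (C + C) => [|s]; first exact: addr_ge0.
rewrite (le_trans (ler_normB _ _))// !normrM lerD//.
  by rewrite -[leRHS]mulr1 ler_pM.
by rewrite -[leRHS]mul1r ler_pM.
Qed.

Definition bump_at z r s : R := bump (r^-1 * (s - z)).

(** This exposes the affine arguments required by the constructors of [flat_algebra]. *)
Lemma bump_atE z r : bump_at z r =
  fun s => flat 1 (1 - r^-1 * z + r^-1 * s) * flat 1 (1 + r^-1 * z + (- r^-1) * s).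
Proof.
by apply/funext => s; rewrite /bump_at /bump; congr (flat _ _ * flat _ _); ring.
Qed.

Lemma flat_algebra_bump_at z r : flat_algebra (bump_at z r).
Proof.
rewrite bump_atE.
by apply: flat_algebraM; exact: flat_algebra_affine.
Qed.

Lemma is_derive_bump_at z r s :
  is_derive s 1 (bump_at z r) (r^-1 * dbump (r^-1 * (s - z))).
Proof.
rewrite bump_atE.
have d := is_deriveM (is_derive_flat_affine 1 (1 - r^-1 * z) r^-1 s)
  (is_derive_flat_affine 1 (1 + r^-1 * z) (- r^-1) s).
apply: (is_derive_eq d); rewrite derivC subr0 mulr1 /dbump /GRing.scale/=.
rewrite (_ : 1 + r^-1 * z + - r^-1 * s = 1 - r^-1 * (s - z)); last by ring.
rewrite (_ : 1 - r^-1 * z + r^-1 * s = 1 + r^-1 * (s - z)); last by ring.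
by ring.
Qed.

Lemma norm_rescaled_ge1 z r s : 0 < r ->
  ~~ (z - r <= s <= z + r) -> 1 <= `|r^-1 * (s - z)|.
Proof.
move=> r0 H; rewrite normrM gtr0_norm ?invr_gt0// ler_pdivlMl// mulr1 leNgt.
apply: contra H; rewrite ltr_norml => /andP[? ?]; lra.
Qed.

Lemma norm_rescaled_le_half z r s : 0 < r ->
  z - r / 2 <= s <= z + r / 2 -> `|r^-1 * (s - z)| <= 2^-1.
Proof.
move=> r0 /andP[? ?]; rewrite normrM gtr0_norm ?invr_gt0// ler_pdivrMl//.
by rewrite ler_norml; lra.
Qed.

(** A product of two bumps rather than a radial one: it is supported in a square, and its partial
    derivatives are one-variable derivatives. *)
Definition cutoff (z : R2) r : R2 -> R := tensor (bump_at z.1 r) (bump_at z.2 r).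

Definition square (z : R2) r : set R2 :=
  `[z.1 - r, z.1 + r] `*` `[z.2 - r, z.2 + r].

Lemma not_square (z y : R2) r : ~ square z r y ->
  ~~ (z.1 - r <= y.1 <= z.1 + r) \/ ~~ (z.2 - r <= y.2 <= z.2 + r).
Proof.
move=> H; apply/orP; rewrite -negb_and; apply/negP => /andP[H1 H2].
by apply: H; split; rewrite /= in_itv.
Qed.

Lemma smooth_cutoff (z : R2) r : smooth (cutoff z r).
Proof. by apply: smooth_tensor; exact: flat_algebra_bump_at. Qed.

Lemma cutoff_ge0 (z : R2) r y : 0 <= cutoff z r y.
Proof. by rewrite mulr_ge0 ?bump_ge0. Qed.

Lemma cutoff_le1 (z : R2) r y : cutoff z r y <= 1.
Proof. by rewrite mulr_ile1 ?bump_ge0 ?bump_le1. Qed.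

Lemma cutoff_eq0 (z : R2) r y : 0 < r -> ~ square z r y -> cutoff z r y = 0.
Proof.
move=> r0 /not_square[] H; rewrite /cutoff /tensor /bump_at.
- by rewrite [X in X * _]bump_eq0 ?mul0r//; exact: norm_rescaled_ge1.
- by rewrite [X in _ * X]bump_eq0 ?mulr0//; exact: norm_rescaled_ge1.
Qed.

(** On the half-size square each of the four [flat 1] factors has an argument at least 1/2, hence is
    at least exp(-2). *)
Lemma cutoff_ge (z : R2) r y : 0 < r -> square z (r / 2) y ->
  expR (- 8) <= cutoff z r y.
Proof.
move=> r0 []; rewrite /= !in_itv/= => h1 h2.
have -> : - 8 = - 4 + - 4 :> R by ring.
by rewrite expRD ler_pM ?expR_ge0// bump_ge// norm_rescaled_le_half.
Qed.

Lemma grad2_cutoff (z : R2) r y : grad2 (cutoff z r) y =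
  (r^-1 * dbump (r^-1 * (y.1 - z.1)) * bump_at z.2 r y.2) ^+ 2 +
  (bump_at z.1 r y.1 * (r^-1 * dbump (r^-1 * (y.2 - z.2)))) ^+ 2.
Proof.
rewrite /grad2.
have [_ ->] := is_derive_tensor1 (bump_at z.2 r) (is_derive_bump_at z.1 r y.1).
by have [_ ->] := is_derive_tensor2 (bump_at z.1 r) (is_derive_bump_at z.2 r y.2).
Qed.

Lemma grad2_cutoff_eq0 (z : R2) r y :
  0 < r -> ~ square z r y -> grad2 (cutoff z r) y = 0.
Proof.
move=> r0 /not_square[] /(norm_rescaled_ge1 r0) H; rewrite grad2_cutoff.
- by rewrite (dbump_eq0 H) /bump_at (bump_eq0 H) !(mulr0, mul0r) expr0n addr0.
- by rewrite (dbump_eq0 H) /bump_at (bump_eq0 H) !(mulr0, mul0r) expr0n addr0.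
Qed.

(** [K] depends neither on [z] nor on [r]; the factor r^-2 will cancel against the area 4 r^2 of the
    square. *)
Lemma grad2_cutoff_le : exists2 K, 0 <= K &
  forall (z : R2) r y, grad2 (cutoff z r) y <= K * (r ^- 2).
Proof.
have [K K0 hK] := dbump_bounded; exists (K ^+ 2 + K ^+ 2).
  by rewrite addr_ge0 ?sqr_ge0.
have h1 s : (dbump s) ^+ 2 <= K ^+ 2.
  by rewrite -real_normK ?num_real// lerXn2r ?nnegrE.
have h2 z' r' s : (bump_at z' r' s) ^+ 2 <= 1.
  by rewrite expr_le1 ?bump_ge0 ?bump_le1.
have h3 (r d b : R) : d ^+ 2 <= K ^+ 2 -> b ^+ 2 <= 1 ->
    (r^-1 * d * b) ^+ 2 <= K ^+ 2 * r ^- 2.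
  move=> dK b1; rewrite !exprMn exprVn (mulrC _ (d ^+ 2)) -[leRHS]mulr1.
  have r0 : 0 <= r ^- 2 by rewrite invr_ge0 sqr_ge0.
  apply: ler_pM; [apply: mulr_ge0| | |exact: b1]; rewrite ?sqr_ge0//.
  by rewrite ler_wpM2r.
move=> z r y; rewrite grad2_cutoff mulrDl (mulrC (bump_at _ _ _)).
by apply: lerD; exact: h3.
Qed.

Lemma enorm_le (y : R2) : enorm y <= `|y.1| + `|y.2|.
Proof.
rewrite /enorm -[leRHS]ger0_norm ?addr_ge0// -sqrtr_sqr ler_wsqrtr//.
rewrite sqrrD !real_normK ?num_real// mulr2n.
have := mulr_ge0 (normr_ge0 y.1) (normr_ge0 y.2); lra.
Qed.

Lemma square_enorm (z y : R2) r :
  square z r y -> enorm y <= `|z.1| + `|z.2| + r *+ 2.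
Proof.
move=> []; rewrite /= !in_itv/= => /andP[a1 a2] /andP[b1 b2].
rewrite (le_trans (enorm_le _))//.
have h1 : `|y.1| <= `|z.1| + r.
  by rewrite ler_norml; have := ler_norm z.1; have := ler_norm (- z.1);
    rewrite normrN; lra.
have h2 : `|y.2| <= `|z.2| + r.
  by rewrite ler_norml; have := ler_norm z.2; have := ler_norm (- z.2);
    rewrite normrN; lra.
rewrite mulr2n; lra.
Qed.

Lemma test_fun_cutoff (z : R2) r : 0 < r -> test_fun (cutoff z r).
Proof.
move=> r0; split; first exact: smooth_cutoff.
exists (`|z.1| + `|z.2| + r *+ 2) => y hy; apply: cutoff_eq0 => //.
by move=> /square_enorm; rewrite leNgt hy.
Qed.

(** The half-diagonal is sqrt(2) r; the cruder factor 2 also makes the inclusion in the open ball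
    strict. *)
Lemma square_sub_eball (z : R2) r : 0 < r -> square z r `<=` eball z (2 * r).
Proof.
move=> r0 y []; rewrite /= !in_itv/= => /andP[a1 a2] /andP[b1 b2].
rewrite /eball/= /enorm/= -[ltRHS]ger0_norm ?mulr_ge0 ?ltW//.
rewrite -sqrtr_sqr ltr_sqrt ?exprn_gt0 ?mulr_gt0//.
have h (t : R) : - r <= t <= r -> t ^+ 2 <= r ^+ 2.
  by rewrite -ler_norml => tr; rewrite -real_normK ?num_real// lerXn2r// nnegrE ltW.
have h1 : (y.1 - z.1) ^+ 2 <= r ^+ 2 by apply: h; lra.
have h2 : (y.2 - z.2) ^+ 2 <= r ^+ 2 by apply: h; lra.
rewrite exprMn.
have : 0 < r ^+ 2 by rewrite exprn_gt0.
lra.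
Qed.

Lemma measurable_square (z : R2) r : measurable (square z r).
Proof. by apply: measurableX; exact: measurable_itv. Qed.

Lemma leb2_square (z : R2) r : 0 < r -> leb2 (square z r) = (4 * r ^+ 2)%:E.
Proof.
move=> r0; rewrite /leb2 product_measure1E; [|exact: measurable_itv..].
rewrite /= !lebesgue_measure_itv/= !lte_fin !ifT; [|lra..].
by rewrite -!EFinB -EFinM; congr EFin; ring.
Qed.

End Bump.

(** * Open sets and continuous functions are measurable for the product sigma-algebra *)

Section PlaneMeasurability.
Variable R : realType.
Local Notation R2 := (R * R)%type.

(** An open set is the union of the open rectangles with rational end points that it contains, and
    there are countably many of these. *)
Lemma open_plane_measurable (A : set R2) : open A -> measurable A.
Proof.
move=> oA.
pose rect (q : (rat * rat) * (rat * rat)) : set R2 :=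
  `]ratr q.1.1, ratr q.1.2[ `*` `]ratr q.2.1, ratr q.2.2[.
(* Rectangles not contained in [A] are replaced by the empty set, so that the union ranges over a
   whole countable type. *)
pose F q : set R2 := if pselect (rect q `<=` A) then rect q else set0.
have -> : A = \bigcup_q F q.
  apply/seteqP; split => [y Ay|y [q _]]; last first.
    by rewrite /F; case: pselect => [qA /qA|_ []].
  have /nbhs_ballP[e /= e0 eA] : nbhs y A by exact: open_nbhs_nbhs.
  have H (t : R) : exists q : rat * rat,
      (t \in `]ratr q.1, ratr q.2[) /\
      forall s, s \in `]ratr q.1, ratr q.2[ -> ball t e s.
    have [a] := @rat_in_itvoo R (t - e) t ltac:(lra).
    have [b] := @rat_in_itvoo R t (t + e) ltac:(lra).
    rewrite !in_itv/= => /andP[b1 b2] /andP[a1 a2].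
    exists (a, b); split; first by rewrite in_itv/= a2 b1.
    move=> s; rewrite in_itv/= => /andP[s1 s2].
    by rewrite /ball/= ltr_norml; lra.
  have [q1 [y1 h1]] := H y.1; have [q2 [y2 h2]] := H y.2.
  exists (q1, q2) => //; rewrite /F; case: pselect => [_|] //=.
  by case=> s [/h1 s1 /h2 s2]; apply: eA.
apply: countable_bigcupT_measurable => // q; rewrite /F.
case: pselect => qA; last exact: measurable0.
by apply: measurableX; exact: measurable_itv.
Qed.

Lemma continuous_plane_measurable (f : R2 -> R) :
  continuous f -> measurable_fun setT f.
Proof.
move=> /continuousP cf.
apply: (measurability _ (RGenOpens.measurableE R)).
move=> _ [_ [a [b ->] <-]]; rewrite setTI; apply: open_plane_measurable.
exact/cf/interval_open.
Qed.

End PlaneMeasurability.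

(** * Bounding integrals by a constant times the measure of a set *)

Section IntegralBounds.
Context d (T : measurableType d) (R : realType).
Variable mu : {measure set T -> \bar R}.
Implicit Types (A : set T) (f : T -> R).
Local Open Scope ereal_scope.

Lemma integral_supported_le A f k : measurable A -> measurable_fun setT f ->
  (forall y, 0 <= f y)%R -> (forall y, A y -> f y <= k)%R ->
  (forall y, ~ A y -> f y = 0%R) ->
  \int[mu]_y (f y)%:E <= k%:E * mu A.
Proof.
move=> mA mf f0 fk fA.
have -> : \int[mu]_y (f y)%:E = \int[mu]_(y in A) (f y)%:E.
  rewrite [RHS]integral_mkcond; apply: eq_integral => y _.
  by rewrite patchE; case: ifPn => //; rewrite notin_setE => /fA ->.
rewrite -(integral_cst mu mA); apply: ge0_le_integral => //.
- by move=> y _; rewrite lee_fin.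
- by apply/measurable_EFinP; exact: measurable_funS mf.
Qed.

Lemma integral_ge_on A f k : measurable A -> measurable_fun setT f ->
  (forall y, 0 <= f y)%R -> (0 <= k)%R -> (forall y, A y -> k <= f y)%R ->
  k%:E * mu A <= \int[mu]_y (f y)%:E.
Proof.
move=> mA mf f0 k0 kf.
have mEf : measurable_fun setT (EFin \o f) by exact/measurable_EFinP.
apply: (@le_trans _ _ (\int[mu]_(y in A) (f y)%:E)).
  rewrite -(integral_cst mu mA); apply: ge0_le_integral => //.
  exact: measurable_funS mEf.
apply: ge0_subset_integral => //.
by move=> y _; rewrite lee_fin.
Qed.

End IntegralBounds.

(** * Norm estimates in the weighted spaces *)

Section WeightedSpaces.
Variables (R : realType) (V : R * R -> R).
Local Notation R2 := (R * R)%type.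
Hypothesis Vc : continuous V.
Hypothesis V0 : forall y, 0 <= V y.

Lemma smooth_measurable (f : R2 -> R) : smooth f -> measurable_fun setT f.
Proof. by move=> /(_ [::] isT)[/continuous_plane_measurable]. Qed.

Lemma smooth_grad2_measurable (f : R2 -> R) :
  smooth f -> measurable_fun setT (grad2 f).
Proof.
move=> sf; have h v : (v == e1 R) || (v == e2 R) -> measurable_fun setT ('D_v f).
  move=> hv; have [] := sf [:: v]; first by rewrite /= hv.
  by move=> /continuous_plane_measurable.
apply: measurable_funD; apply: measurable_funX; apply: h; rewrite eqxx//.
by rewrite orbT.
Qed.

Lemma HV_norm2_ge0 (f : R2 -> R) : (0 <= HV_norm2 V f)%E.
Proof.
apply: integral_ge0 => y _; rewrite lee_fin addr_ge0//.
  by rewrite /grad2 addr_ge0 ?sqr_ge0.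
by rewrite mulr_ge0 ?sqr_ge0.
Qed.

Lemma HV_norm2_supported_le (f : R2 -> R) (A : set R2) (a b : R) :
  measurable A -> smooth f ->
  (forall y, A y -> grad2 f y <= a) -> (forall y, A y -> V y * f y ^+ 2 <= b) ->
  (forall y, ~ A y -> grad2 f y = 0) -> (forall y, ~ A y -> f y = 0) ->
  (HV_norm2 V f <= (a + b)%:E * leb2 A)%E.
Proof.
move=> mA sf fa fb ga0 fa0; apply: integral_supported_le => //.
- apply: measurable_funD; first exact: smooth_grad2_measurable.
  apply: measurable_funM; first exact: continuous_plane_measurable.
  by apply: measurable_funX; exact: smooth_measurable.
- move=> y; rewrite addr_ge0//; first by rewrite /grad2 addr_ge0 ?sqr_ge0.
  by rewrite mulr_ge0 ?sqr_ge0.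
- by move=> y Ay; rewrite lerD ?fa ?fb.
- by move=> y Ay; rewrite ga0// fa0// expr0n mulr0 addr0.
Qed.

Lemma HV_norm2_0 : HV_norm2 V (fun=> 0) = 0%E.
Proof.
rewrite /HV_norm2 -[RHS](integral0 (@leb2 R) setT); apply: eq_integral => y _.
by rewrite /grad2 !derive_cst expr0n mulr0 !addr0.
Qed.

(** All differences in the constant sequence vanish identically, so both the Cauchy condition and
    the convergence are trivial. *)
Lemma H1V_approx_cst (f : R2 -> R) : test_fun f -> (HV_norm2 V f < +oo)%E ->
  H1V_approx V f (fun=> f).
Proof.
move=> tf foo; have f0 : f \- f = fun=> 0 by apply/funext => y /=; rewrite subrr.
split => //.
- move=> e e0; near=> p; rewrite f0 /HV_norm HV_norm2_0/= sqrtr0//.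
- by apply: smooth_measurable; case: tf.
- rewrite f0 (_ : LtauV_int V 2 _ = 0%E); first exact: cvg_cst.
  rewrite /LtauV_int -[RHS](integral0 (@leb2 R) setT).
  by apply: eq_integral => y _; rewrite normr0 powR0 ?mulr0.
Unshelve. all: by end_near. Qed.

Lemma H1V_norm_along_cst (f : R2 -> R) :
  H1V_norm_along V (fun=> f) = HV_norm V f.
Proof. exact: lim_cst. Qed.

Lemma HV_norm_le (f : R2 -> R) (M : R) : (HV_norm2 V f <= M%:E)%E ->
  HV_norm V f <= Num.sqrt M.
Proof.
move=> fM; rewrite /HV_norm ler_wsqrtr// -lee_fin fineK//.
by rewrite ge0_fin_numE ?HV_norm2_ge0// (le_lt_trans fM)// ltry.
Qed.

(** From |a - b| <= 2 max(|a|, |b|), which works for every p >= 0 without convexity. *)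
Lemma powR_normD_le (a b p : R) : 0 <= p ->
  `|a - b| `^ p <= 2 `^ p * (`|a| `^ p + `|b| `^ p).
Proof.
move=> p0; wlog ab : a b / `|a| <= `|b|.
  move=> H; have [/H//|/ltW/H] := leP `|a| `|b|.
  by rewrite distrC (addrC (`|b| `^ p)).
apply: (@le_trans _ _ ((2 * `|b|) `^ p)).
  apply: ge0_ler_powR; rewrite ?nnegrE ?mulr_ge0//.
  by rewrite (le_trans (ler_normB _ _))// mulr_natl mulr2n lerD2r.
by rewrite powRM// ler_wpM2l ?powR_ge0// lerDr powR_ge0.
Qed.

Lemma LtauV_integrand_measurable (tau : R) (f : R2 -> R) : measurable_fun setT f ->
  measurable_fun setT (fun y => V y * `|f y| `^ tau).
Proof.
move=> mf; apply: measurable_funM; first exact: continuous_plane_measurable.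
apply: (measurableT_comp (measurable_powR tau)).
exact: (measurableT_comp (@normr_measurable R setT)).
Qed.

(* On [A] the difference of [u - w] and [u' - w] is [u], so both cannot be
   small in L^tau_V at the same time. *)
Lemma LtauV_separation (tau : R) (u u' w : R2 -> R) (A : set R2) (a v : R) :
  0 <= tau -> 0 <= a -> 0 <= v -> measurable A ->
  measurable_fun setT u -> measurable_fun setT u' -> measurable_fun setT w ->
  (forall y, A y -> v <= V y) -> (forall y, A y -> a <= `|u y|) ->
  (forall y, A y -> u' y = 0) ->
  ((v * a `^ tau)%:E * leb2 A <= (2 `^ tau)%:E *
     (LtauV_int V tau (u \- w)%R + LtauV_int V tau (u' \- w)%R))%E.
Proof.
move=> tau0 a0 v0 mA mu mu' mw vV au u'0.
have h0 (f : R2 -> R) y : 0 <= V y * `|f y| `^ tau by rewrite mulr_ge0 ?powR_ge0.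
have muw : measurable_fun setT (u \- w) by exact: measurable_funB.
have mu'w : measurable_fun setT (u' \- w) by exact: measurable_funB.
have m1 := LtauV_integrand_measurable tau muw.
have m2 := LtauV_integrand_measurable tau mu'w.
have i1 y : (0 <= (V y * `|(u \- w) y| `^ tau)%:E)%E by rewrite lee_fin.
have i2 y : (0 <= (V y * `|(u' \- w) y| `^ tau)%:E)%E by rewrite lee_fin.
have em1 : measurable_fun setT (fun y => (V y * `|(u \- w) y| `^ tau)%:E).
  exact/measurable_EFinP.
have em2 : measurable_fun setT (fun y => (V y * `|(u' \- w) y| `^ tau)%:E).
  exact/measurable_EFinP.
(* The right-hand side becomes a single integral, so that a pointwise lower bound on [A] is
   enough. *)
rewrite /LtauV_int -ge0_integralD// -ge0_integralZl//; last 2 first.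
- exact: emeasurable_funD.
- by move=> y _; rewrite adde_ge0.
under eq_integral do rewrite -EFinD -EFinM.
apply: integral_ge_on => //.
- by apply: measurable_funM => //; exact: measurable_funD.
- by move=> y; rewrite mulr_ge0 ?powR_ge0// addr_ge0.
- by rewrite mulr_ge0 ?powR_ge0.
move=> y Ay; rewrite -mulrDr mulrCA; apply: ler_pM; rewrite ?powR_ge0 ?vV//.
apply: (le_trans _ (powR_normD_le _ _ tau0)).
apply: ge0_ler_powR; rewrite ?nnegrE//.
by rewrite /= u'0// sub0r opprK subrK au.
Qed.

End WeightedSpaces.

(** * Escape of the supports to infinity and the final contradiction *)

Lemma increasing_seq_ge_id (s : nat -> nat) :
  (forall n, (s n < s n.+1)%N) -> forall n, (n <= s n)%N.
Proof. by move=> h; elim=> // n IH; exact: leq_ltn_trans IH (h n). Qed.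

(** By the triangle inequality in each coordinate, [z] lies in the square of half-side r + r' around
    [z']. *)
Lemma squares_meet_enorm_le (R : realType) (z z' y : R * R) (r r' : R) :
  square z r y -> square z' r' y ->
  enorm z <= `|z'.1| + `|z'.2| + (r + r') *+ 2.
Proof.
move=> [/=]; rewrite !in_itv/= => /andP[a1 a2] /andP[b1 b2].
move=> [/=]; rewrite !in_itv/= => /andP[c1 c2] /andP[d1 d2].
rewrite (le_trans _ (@square_enorm R z' z (r + r') _))//.
by split; rewrite /= in_itv/=; lra.
Qed.

Theorem proposition2p7 (R : realType) (V : R * R -> R) (tau : R)
  (c1 c2 m : R) (x : nat -> (R * R)%type) :
  continuous V ->
  (exists delta : R, 0 < delta /\ forall y, delta <= V y) ->
  2 < tau ->
  cont_embed V tau ->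
  0 < c1 -> 0 < c2 -> 0 < m ->
  (fun n => enorm (x n)) @ \oo --> +oo ->
  (forall n, (0 < n)%N -> forall y, eball (x n) (m / Num.sqrt (V (x n))) y ->
      c1 * V (x n) <= V y /\ V y <= c2 * V (x n)) ->
  ~ compact_embed V tau.
Proof.
move=> Vc [delta [delta0 Vdelta]] tau2 _ c10 c20 m0 xoo Vx cV.
have Vgt0 y : 0 < V y by exact: lt_le_trans (Vdelta y).
have Vge0 y : 0 <= V y by exact: ltW.
(* The shift of index respects the restriction to n >= 1. The 2 in the denominator makes the square
   of half-side [r n] fit in the ball where [V] is controlled. *)
pose z n := x n.+1; pose r n := m / (2 * Num.sqrt (V (z n))).
have sV n : 0 < Num.sqrt (V (z n)) by rewrite sqrtr_gt0.
have r0 n : 0 < r n by rewrite divr_gt0// mulr_gt0.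
(* This scale invariance makes both the upper and the lower bounds uniform in [n]. *)
have Vr n : V (z n) * r n ^+ 2 = m ^+ 2 / 4.
  rewrite /r -[X in X * _](sqr_sqrtr (Vge0 (z n))).
  by field; rewrite gt_eqF.
have Vz n y : square (z n) (r n) y -> c1 * V (z n) <= V y /\ V y <= c2 * V (z n).
  move=> /(square_sub_eball (r0 n)) zy; apply: Vx => //.
  suff -> : m / Num.sqrt (V (x n.+1)) = 2 * r n by [].
  by rewrite /r -/(z n); field; rewrite gt_eqF.
pose u n := cutoff (z n) (r n).
have [K K0 hK] := grad2_cutoff_le R.
have uM n : (HV_norm2 V (u n) <= (4 * K + c2 * m ^+ 2)%:E)%E.
  have H : (HV_norm2 V (u n) <=
      (K * r n ^- 2 + c2 * V (z n))%:E * leb2 (square (z n) (r n)))%E.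
    apply: HV_norm2_supported_le => //.
    - exact: measurable_square.
    - exact: smooth_cutoff.
    - by move=> y _; exact: hK.
    - move=> y zy; rewrite -[leRHS]mulr1.
      apply: ler_pM; rewrite ?sqr_ge0 ?(Vz n y zy).2//.
      by rewrite expr_le1 ?cutoff_ge0 ?cutoff_le1.
    - by move=> y; exact: grad2_cutoff_eq0.
    - by move=> y; exact: cutoff_eq0.
  rewrite (le_trans H)// leb2_square// -EFinM lee_fin.
  have -> : (K * r n ^- 2 + c2 * V (z n)) * (4 * r n ^+ 2) =
      4 * K + c2 * (4 * (V (z n) * r n ^+ 2)).
    by field; rewrite gt_eqF.
  by rewrite Vr; lra.
have ua n : H1V_approx V (u n) (fun=> u n).
  apply: H1V_approx_cst => //; first exact: test_fun_cutoff.
  by rewrite (le_lt_trans (uM n))// ltry.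
have [||s [w [sincr [[mw _] cvgw]]]] := cV u.
- by move=> n; exists (fun=> u n).
- exists (Num.sqrt (4 * K + c2 * m ^+ 2)) => n; exists (fun=> u n); split => //.
  by rewrite H1V_norm_along_cst; exact: HV_norm_le.
(* The lower bound for the L^tau_V integral of any bump: [V] is at least c1 V(z n) and the bump at
   least exp(-8) on the half-size square, whose area is (r n)^2. *)
pose kap : R := c1 * expR (- 8) `^ tau * (m ^+ 2 / 4).
have kap0 : 0 < kap.
  by rewrite mulr_gt0 ?mulr_gt0 ?powR_gt0 ?expR_gt0 ?divr_gt0 ?exprn_gt0.
have t2 : 0 < 2 `^ tau :> R by rewrite powR_gt0.
(* Chosen so that 2^tau (eps + eps) = kap / 2, which is less than [kap]. *)
pose eps := kap / (2 `^ tau * 4).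
have eps0 : 0 < eps by rewrite divr_gt0// mulr_gt0.
have [N _ hN] : \forall n \near \oo,
    (LtauV_int V tau (u (s n) \- w)%R < eps%:E)%E.
  have /fine_cvgP[fin c0] := cvgw.
  apply: filterS2 fin (cvgr_lt _ c0 _ eps0) => n fn.
  by rewrite -[X in (X < _)%E](fineK fn) lte_fin.
have hNN := hN N (leqnn N).
set n := s N in hNN.
(* A bound for all the half-sides at once, since [V] is at least [delta]. *)
pose rho := m / (2 * Num.sqrt delta).
have r_rho k : r k <= rho.
  rewrite /r /rho; apply: ler_wpM2l; first exact: ltW.
  rewrite lef_pV2 ?posrE ?mulr_gt0 ?sqrtr_gt0//.
  by rewrite ler_pM2l// ler_wsqrtr.
(* Centres this far out have squares that miss the one around [z n]; the + 1 makes the comparison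
   strict. *)
have [N' _ hN'] : \forall k \near \oo,
    `|(z n).1| + `|(z n).2| + (rho + rho) *+ 2 + 1 <= enorm (x k).
  by have /cvgryPge := xoo; apply.
(* Past [N] the bump is close to [w]; past [N'] its support is far away, because s k >= k. *)
pose k := maxn N N'.
have hNk := hN k (leq_maxl _ _).
have zk : `|(z n).1| + `|(z n).2| + (rho + rho) *+ 2 + 1 <= enorm (z (s k)).
  apply: hN' => /=; rewrite (leq_trans (leq_maxr N N'))// -/k.
  by rewrite (leq_trans (increasing_seq_ge_id sincr k)).
have subsq y : square (z n) (r n / 2) y -> square (z n) (r n) y.
  move=> []; rewrite /= !in_itv/= => /andP[? ?] /andP[? ?].
  by have := r0 n; split; rewrite /= in_itv/=; lra.
have H : ((c1 * V (z n) * expR (- 8) `^ tau)%:E *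
    leb2 (square (z n) (r n / 2)) <= (2 `^ tau)%:E *
      (LtauV_int V tau (u n \- w)%R + LtauV_int V tau (u (s k) \- w)%R))%E.
  apply: LtauV_separation => //.
  - by lra.
  - by rewrite mulr_ge0// ltW.
  - exact: measurable_square.
  - by apply: smooth_measurable; exact: smooth_cutoff.
  - by apply: smooth_measurable; exact: smooth_cutoff.
  - by move=> y /subsq/Vz[].
  - by move=> y yn; rewrite ger0_norm ?cutoff_ge0// cutoff_ge.
  (* A common point of the two squares would bound the norm of [z (s k)] and contradict [zk]. *)
  - move=> y yn; apply: cutoff_eq0 => // yk.
    have := squares_meet_enorm_le yk (subsq _ yn); rewrite leNgt => /negP; apply.
    rewrite (lt_le_trans _ zk)//.
    by have := r_rho n; have := r_rho (s k); rewrite !mulr2n; lra.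
(* Both bumps are within [eps] of [w], so separation yields kap <= kap / 2, which is absurd. *)
have : (kap%:E <= (2 `^ tau)%:E * (eps%:E + eps%:E))%E.
  have -> : kap%:E = ((c1 * V (z n) * expR (- 8) `^ tau)%:E *
      leb2 (square (z n) (r n / 2)))%E.
    have r20 : 0 < r n / 2 by rewrite divr_gt0.
    rewrite (leb2_square _ r20) -EFinM /kap -(Vr n); congr EFin.
    move: (expR (- 8) `^ tau) (V (z n)) (r n) => a b c.
    by field.
  rewrite (le_trans H)// lee_pmul2l ?lte_fin//.
  exact: leeD (ltW hNN) (ltW hNk).
rewrite -EFinD -EFinM lee_fin leNgt => /negP; apply.
rewrite /eps (_ : _ * (_ + _) = kap / 2); first by lra.
by field; rewrite gt_eqF.
Qed.
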